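(* Let $C$ be a connected simplicial complex or a connected cubical complex (of arbitrary dimension, possibly infinite), equipped with its natural path metric. The metric on $C$ is complete if and only if $C$ does not contain an infinite (strictly) ascending sequence of cells.
   Context: A cubical complex is obtained by gluing cubes along faces by isometries so that each closed cube embeds and any two closed cubes meet in the empty set or a single common face. Each $n$-cube is metrized as a standard Euclidean cube of side length 1. Each $n$-simplex of a simplicial complex is given the ''all right metric'': it is metrized as the subspace $S^n\cap(\mathbb{R}_{\ge0})^{n+1}$ of the unit sphere $S^n\subset\mathbb{R}^{n+1}$ with its Riemannian (angular) metric. The cells of $C$ are its simplices (respectively cubes). The distance between $x,y\in C$ is the infimum of the sums $\sum_{i=1}^nd(x_{i-1},x_i)$ over sequences $x=x_0,x_1,\dots,x_n=y$ such that for each $i$ there is a single cell containing $x_{i-1}$ and $x_i$, the distance $d(x_{i-1},x_i)$ being measured in that cell. This defines a metric on $C$. Ascending refers to inclusion of closed cells. *)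

(* Defs.v *)
From HB Require Import structures.
From mathcomp Require Import all_boot all_order all_algebra finmap.
From mathcomp Require Import all_classical all_reals all_analysis.

Set Implicit Arguments.
Unset Strict Implicit.
Unset Printing Implicit Defensive.

Import Order.TTheory GRing.Theory Num.Theory.
Local Open Scope classical_set_scope.
Local Open Scope ring_scope.

(* A set of points together with its closed cells.  [cell_dist i] is the metric
   of the cell [i]; only its values on points of [cell i] are meaningful.  The
   same subset may be indexed several times: cells are compared as subsets. *)
Record cell_space (R : realType) := CellSpace {
  carrier : Type;
  cell_index : Type;
  cell : cell_index -> set carrier;
  cell_dist : cell_index -> carrier -> carrier -> R }.

Section CellSpaceTheory.
Variables (R : realType) (C : cell_space R).

(* Lengths of the chains x = z 0, ..., z n = y in which z i and z i.+1 lie in the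
   single cell c i. *)
Definition chain_lengths (x y : carrier C) : set R :=
  [set l | exists (n : nat) (z : nat -> carrier C) (c : nat -> cell_index C),
    [/\ z 0%N = x, z n = y,
        forall i, (i < n)%N -> cell (c i) (z i) /\ cell (c i) (z i.+1) &
        l = \sum_(i < n) cell_dist (c i) (z i) (z i.+1)] ].

(* If x and y are joined by no chain, this is the junk value inf set0 = 0; that
   does not happen when C is connected. *)
Definition path_dist (x y : carrier C) : R := inf (chain_lengths x y).

Definition cauchy_sequence (u : nat -> carrier C) : Prop :=
  forall e : R, 0 < e -> exists N : nat, forall m n : nat,
    (N <= m)%N -> (N <= n)%N -> path_dist (u m) (u n) < e.

Definition converges_to (u : nat -> carrier C) (l : carrier C) : Prop :=
  forall e : R, 0 < e -> exists N : nat, forall n : nat,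
    (N <= n)%N -> path_dist (u n) l < e.

Definition path_metric_complete : Prop :=
  forall u : nat -> carrier C, cauchy_sequence u -> exists l, converges_to u l.

Definition infinite_ascending (s : nat -> cell_index C) : Prop :=
  forall n : nat, cell (s n) `<` cell (s n.+1).

(* The topology coherent with the cells: a set is open iff its intersection with
   every closed cell is open in the metric of that cell. *)
Definition coherent_open (U : set (carrier C)) : Prop :=
  forall (i : cell_index C) (x : carrier C), cell i x -> U x ->
    exists2 e : R, 0 < e &
      forall y, cell i y -> cell_dist i x y < e -> U y.

Lemma coherent_openT : coherent_open setT.
Proof. by move=> i x _ _; exists 1. Qed.

Lemma coherent_openI : setI_closed coherent_open.
Proof.
move=> U V oU oV i x ix [Ux Vx].
have [e e0 eU] := oU i x ix Ux; have [f f0 fV] := oV i x ix Vx.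
exists (Num.min e f); first by rewrite lt_min e0.
by move=> y iy; rewrite lt_min => /andP[ye yf]; split; [exact: eU|exact: fV].
Qed.

Lemma coherent_open_bigcup (I : Type) (U : I -> set (carrier C)) :
  (forall j, coherent_open (U j)) -> coherent_open (\bigcup_j U j).
Proof.
move=> oU i x ix [j _ Ujx]; have [e e0 eU] := oU j i x ix Ujx.
by exists e => // y iy ye; exists j => //; exact: eU.
Qed.

HB.instance Definition _ := gen_eqMixin (carrier C).
HB.instance Definition _ := gen_choiceMixin (carrier C).
HB.instance Definition _ := isOpenTopological.Build (carrier C)
  coherent_openT coherent_openI coherent_open_bigcup.

End CellSpaceTheory.

Record simplicial_complex := SimplicialComplex {
  vertex : choiceType;
  simplex : set {fset vertex};
  simplex_neq0 : forall s, simplex s -> s != fset0;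
  simplex_vertex : forall v : vertex, simplex [fset v]%fset;
  simplex_face : forall s t : {fset vertex},
    simplex s -> (t `<=` s)%fset -> t != fset0 -> simplex t }.

Section AllRight.
Variables (R : realType) (K : simplicial_complex).

(* Spherical coordinates: the points of the simplex s are the unit vectors of the
   nonnegative orthant of R^s, extended by 0 to the other vertices. *)
Definition realization : Type :=
  {x : {fsfun vertex K -> R with 0} |
    [/\ simplex (finsupp x), forall v, 0 <= x v &
        \sum_(v <- finsupp x) x v ^+ 2 = 1]}.

Definition closed_simplex (s : {s : {fset vertex K} | simplex s}) :
    set realization :=
  [set x | (finsupp (sval x) `<=` sval s)%fset].

Definition angular_dist (s : {s : {fset vertex K} | simplex s})
    (x y : realization) : R :=
  acos (\sum_(v <- sval s) sval x v * sval y v).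

Definition all_right : cell_space R := CellSpace closed_simplex angular_dist.

End AllRight.

Definition unit_cube (R : realType) (n : nat) : set 'rV[R]_n :=
  [set u | forall i, 0 <= u 0 i <= 1].

(* A face of the n-cube fixes some coordinates: f i = Some b fixes the i-th one to
   be b (read as 0 or 1), f i = None leaves it free. *)
Definition cube_face (R : realType) (n : nat) (f : 'I_n -> option bool) :
    set 'rV[R]_n :=
  [set u | unit_cube u /\ forall i b, f i = Some b -> u 0 i = b%:R].

Definition euclidean_dist (R : realType) (n : nat) (u v : 'rV[R]_n) : R :=
  Num.sqrt (\sum_i (u 0 i - v 0 i) ^+ 2).

(* The space is the quotient of the disjoint union of the unit cubes by the
   identifications u ~ v iff cube_map c u = cube_map c' v.  The last field says
   that two cubes which meet do so in a common face, along an isometry h between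
   their respective faces f and f'.  Values of cube_map outside the unit cube
   are irrelevant. *)
Record cubical_complex (R : realType) := CubicalComplex {
  cube_point : Type;
  cube : Type;
  cube_dim : cube -> nat;
  cube_map : forall c : cube, 'rV[R]_(cube_dim c) -> cube_point;
  cube_map_cover : forall x, exists c u, unit_cube u /\ @cube_map c u = x;
  cube_map_inj : forall c u v, unit_cube u -> unit_cube v ->
    @cube_map c u = @cube_map c v -> u = v;
  cube_map_glue : forall c c',
    @cube_map c @` @unit_cube R (cube_dim c) `&`
      @cube_map c' @` @unit_cube R (cube_dim c') !=set0 ->
    exists (f : 'I_(cube_dim c) -> option bool)
           (f' : 'I_(cube_dim c') -> option bool)
           (h : 'rV[R]_(cube_dim c) -> 'rV[R]_(cube_dim c')),
      [/\ h @` cube_face f = cube_face f',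
          forall u v, cube_face f u -> cube_face f v ->
            euclidean_dist (h u) (h v) = euclidean_dist u v &
          forall u v, unit_cube u -> unit_cube v ->
            (@cube_map c u = @cube_map c' v <-> cube_face f u /\ v = h u)] }.

Section Cubical.
Variables (R : realType) (K : cubical_complex R).

Definition cube_coord (c : cube K) (x : cube_point K) : 'rV[R]_(cube_dim c) :=
  xget 0 [set u | unit_cube u /\ cube_map u = x].

(* The closed cells are all faces of the given cubes. *)
Definition cubical_cell_index : Type :=
  {c : cube K & 'I_(cube_dim c) -> option bool}.

Definition cubical_cells : cell_space R :=
  @CellSpace R (cube_point K) cubical_cell_index
    (fun i => @cube_map R K (projT1 i) @` cube_face (projT2 i))
    (fun i x y =>
      euclidean_dist (cube_coord (projT1 i) x) (cube_coord (projT1 i) y)).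

End Cubical.

(* Main.v *)
Require Import Defs.
From mathcomp Require Import all_boot all_order all_algebra finmap.
From mathcomp Require Import all_classical all_reals all_analysis.
From mathcomp Require Import ring lra.

Set Implicit Arguments.
Unset Strict Implicit.
Unset Printing Implicit Defensive.

Import Order.TTheory GRing.Theory Num.Theory.
Import numFieldNormedType.Exports.

Local Open Scope classical_set_scope.

(** The path metric is compared with an l2-metric in suitable coordinates.

    A chart is a set of points with real coordinates such that, at a point whose
    coordinates are all below some bound M, every cell through that point stays
    in the chart and has a metric dominating the l2-distance of coordinates.
    Summing along a chain, the path metric itself dominates the l2-distance
    around every point whose coordinates are well below M ([chart_path_dist]).

    In a simplicial complex the spherical coordinates form a single global chart,
    because a chord is shorter than its arc ([vcoord_chart]).  A cubical complex
    has no global coordinates, and the chart is the star of a vertex V: a cube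
    containing V has a coordinate for each of its edges at V, and that edge is
    named by its other end, so that different cubes share their coordinates.  A
    cube not containing V meets the star only where some coordinate is 1
    ([star_exit]), whereas a point of a cube has coordinates at most 1/2 seen
    from the nearest vertex of that cube ([star_cover]).  Hence every point has
    a chart of a uniform radius, although the dimensions are unbounded.

    Suppose no sequence of cells is infinitely ascending, and take a Cauchy
    sequence.  It eventually lies in one chart, where its coordinates converge
    in l2.  Finitely many non-zero coordinates of the limit are also non-zero at
    all late terms, so the corresponding directions span a cell.  Infinitely many
    of them would thus give an ascending sequence of cells; so there are finitely
    many, the limit vector is a point of a cell, and late terms share a cell with
    that point, in which their distance to it is controlled by the l2-distance
    ([complete_of_charts]).

    Conversely an ascending sequence of cells provides one new coordinate at each
    step.  Giving the first n of them fixed square-summable non-zero values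
    yields a Cauchy sequence; its limit would have infinitely many non-zero
    coordinates, whereas a point has only finitely many ([incomplete_of_chart]). *)

Local Open Scope ring_scope.

(** * The l2-metric on real functions *)

Lemma infinite_set_inj (T : Type) (A : set T) : infinite_set A ->
  exists2 e : nat -> T, injective e & forall n, A (e n).
Proof.
move=> /infiniteP/card_leP[f]; exists (fun n => val (f (to_setT n))) => [m n|n].
  by move=> /val_inj h; apply: (congr1 val (inj _ _ h)); rewrite in_setT.
exact: set_valP.
Qed.

Section L2.
Variables (R : realType) (E : choiceType).
Implicit Types (x y z : E -> R) (r s : R) (F : seq E).

(** Bounding all finite partial sums avoids any summability condition, and lets
    the bound pass to coordinatewise limits. *)
Definition l2_le x y r :=
  forall F, uniq F -> \sum_(w <- F) (x w - y w) ^+ 2 <= r ^+ 2.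

Lemma l2_le_mono x y r s : 0 <= r -> r <= s -> l2_le x y r -> l2_le x y s.
Proof.
move=> r0 rs xy F /xy h; apply: le_trans h _.
by rewrite lerXn2r ?nnegrE // (le_trans r0).
Qed.

Lemma l2_le_sym x y r : l2_le x y r -> l2_le y x r.
Proof.
move=> xy F uF; rewrite (eq_bigr (fun w => (x w - y w) ^+ 2)) ?xy // => w _.
by rewrite -opprB sqrrN.
Qed.

Lemma l2_le_coord x y r w : 0 <= r -> l2_le x y r -> `|x w - y w| <= r.
Proof.
move=> r0 /(_ [:: w] isT); rewrite big_seq1 => h.
by rewrite -(ler_pXn2r (ltn0Sn 1)) ?nnegrE // real_normK ?num_real.
Qed.

Lemma l2_le_refl x r : l2_le x x r.
Proof.
by move=> F _; rewrite big1 ?sqr_ge0 // => w _; rewrite subrr expr0n.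
Qed.

Lemma l2_le0 x y : l2_le x y 0 -> x = y.
Proof.
move=> xy; apply/funext => w; apply/eqP; rewrite -subr_eq0 -normr_le0.
exact: l2_le_coord xy.
Qed.

(** Minkowski's inequality, by weighted AM-GM: for r, s > 0,
    (a + b)^2 <= (1 + s/r) a^2 + (1 + r/s) b^2 term by term. *)
Lemma l2_le_triangle x y z r s : 0 <= r -> 0 <= s ->
  l2_le x y r -> l2_le y z s -> l2_le x z (r + s).
Proof.
rewrite le_eqVlt => /predU1P[<- _ /l2_le0 -> | r0]; first by rewrite add0r.
rewrite le_eqVlt => /predU1P[<- xy /l2_le0 <- | s0]; first by rewrite addr0.
move=> xy yz F uF.
pose a w := x w - y w; pose b w := y w - z w.
apply: (@le_trans _ _ ((1 + s / r) * \sum_(w <- F) a w ^+ 2 +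
                       (1 + r / s) * \sum_(w <- F) b w ^+ 2)).
  rewrite !mulr_sumr -big_split /=; apply: ler_sum => w _.
  rewrite -subr_ge0.
  have -> : (1 + s / r) * a w ^+ 2 + (1 + r / s) * b w ^+ 2 - (x w - z w) ^+ 2
          = (s * a w - r * b w) ^+ 2 / (r * s).
    by rewrite /a /b; field; rewrite !gt_eqF.
  by rewrite divr_ge0 ?sqr_ge0 // mulr_ge0 // ltW.
have -> : (r + s) ^+ 2 = (1 + s / r) * r ^+ 2 + (1 + r / s) * s ^+ 2.
  by field; rewrite !gt_eqF.
apply: lerD; apply: ler_wpM2l;
  by rewrite ?addr_ge0 ?divr_ge0 ?(ltW r0) ?(ltW s0) ?xy ?yz.
Qed.

Lemma sum_sub_le F F' (g : E -> R) : uniq F -> (forall w, 0 <= g w) ->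
  (forall w, g w != 0 -> w \in F') -> \sum_(w <- F) g w <= \sum_(w <- F') g w.
Proof.
move=> uF g0 gF'.
rewrite (bigID (fun w => g w != 0)) /= [X in _ + X]big1 ?addr0; last first.
  by move=> w /negPn /eqP.
rewrite -big_filter.
have us : uniq [seq w <- F | g w != 0] by rewrite filter_uniq.
have ss : {subset [seq w <- F | g w != 0] <= F'}.
  by move=> w; rewrite mem_filter => /andP[/gF'].
apply: le_trans (_ : \sum_(w <- undup F') g w <= _).
  rewrite [X in _ <= X](bigID (mem [seq w <- F | g w != 0])) /=.
  rewrite -[X in _ <= X + _]big_filter.
  rewrite -[X in X <= _]addr0 lerD ?sumr_ge0 //.
  rewrite (perm_big [seq i <- undup F' | i \in [seq w <- F | g w != 0]]) //.
  apply: uniq_perm; rewrite ?filter_uniq ?undup_uniq // => w.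
  rewrite mem_filter mem_undup.
  by apply/idP/andP => [h|[]//]; rewrite h ss.
elim: F' {gF' ss} => [|w F' IH] /=; first by rewrite !big_nil.
case: ifP => _; rewrite !big_cons ?lerD // (le_trans IH) // lerDr //.
Qed.

Definition l2_cauchy (a : nat -> E -> R) :=
  forall e, 0 < e -> exists N, forall m n, (N <= m)%N -> (N <= n)%N ->
    l2_le (a m) (a n) e.

Definition l2_cvg (a : nat -> E -> R) x :=
  forall e, 0 < e -> exists N, forall n, (N <= n)%N -> l2_le (a n) x e.

(** The coordinates converge since R is complete; each finite partial sum of the
    Cauchy estimate then passes to the limit. *)
Lemma l2_complete a : l2_cauchy a -> exists x, l2_cvg a x.
Proof.
move=> ca.
have cvga w : cvg (a n w @[n --> \oo]).
  apply/cauchy_cvgP/cauchy_ballP => e e0; near_simpl.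
  have [N HN] := ca _ (divr_gt0 e0 (ltr0n R 2)).
  exists ([set n | (N <= n)%N], [set n | (N <= n)%N]).
    by split; exists N.
  move=> [m n] /= [Nm Nn]; rewrite -ball_normE /=.
  apply: le_lt_trans (l2_le_coord w _ (HN m n Nm Nn)) _; lra.
pose x w : R := lim (a n w @[n --> \oo]).
exists x => e e0; have [N HN] := ca _ e0; exists N => n Nn F uF.
have cF : (\sum_(w <- F) (a n w - a m w) ^+ 2) @[m --> \oo] -->
          \sum_(w <- F) (a n w - x w) ^+ 2.
  apply: cvg_big => [|w _]; first exact: add_continuous.
  have h : (a n w - a m w) @[m --> \oo] --> a n w - x w.
    by apply: cvgB; [exact: cvg_cst | exact: cvga].
  by rewrite expr2; under eq_fun do rewrite expr2; apply: cvgM.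
rewrite -(cvg_lim _ cF) //; apply: limr_le; first exact: cvgP cF.
by exists N => // m /= Nm; exact: HN.
Unshelve. all: by end_near.
Qed.

Lemma l2_cvg_neq0 a x : l2_cvg a x -> forall F, (forall w, w \in F -> x w != 0) ->
  exists N, forall n, (N <= n)%N -> forall w, w \in F -> a n w != 0.
Proof.
move=> ax; elim=> [|w F IH] xF; first by exists 0%N.
have [N HN] := IH (fun v vF => xF v (mem_behead (s := w :: F) vF)).
have xw : 0 < `|x w| / 2 by rewrite divr_gt0 ?normr_gt0 ?xF ?mem_head.
have [N' HN'] := ax _ xw.
exists (maxn N N') => n; rewrite geq_max => /andP[Nn N'n] v.
rewrite inE => /predU1P[->|]; last exact: HN.
apply/eqP => anw; have := l2_le_coord w (ltW xw) (HN' n N'n).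
by rewrite anw sub0r normrN; lra.
Qed.

Lemma l2_cvg_ge0 a x : l2_cvg a x -> (forall n w, 0 <= a n w) -> forall w, 0 <= x w.
Proof.
move=> ax a0 w; rewrite leNgt; apply/negP => xw.
have xw' : 0 < - x w / 2 by lra.
have [N /(_ _ (leqnn N))] := ax _ xw'.
by move=> /(l2_le_coord w (ltW xw')); rewrite ler_norml; have := a0 N w; lra.
Qed.

Lemma l2_cvg_le a x M : l2_cvg a x -> (forall n w, a n w <= M) -> forall w, x w <= M.
Proof.
move=> ax a0 w; rewrite leNgt; apply/negP => xw.
have xw' : 0 < (x w - M) / 2 by lra.
have [N /(_ _ (leqnn N))] := ax _ xw'.
by move=> /(l2_le_coord w (ltW xw')); rewrite ler_norml; have := a0 N w; lra.
Qed.

End L2.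

(** * Charts of a cell space *)

Section CellSpace.
Variables (R : realType) (C : cell_space R).
Local Notation X := (carrier C).

Definition cell_dist_ge0 :=
  forall (i : cell_index C) (x y : X), cell i x -> cell i y -> 0 <= cell_dist i x y.

Definition joined (x y : X) := chain_lengths x y !=set0.

Lemma chain_step (x y z : X) l i : chain_lengths x y l -> cell i y -> cell i z ->
  chain_lengths x z (l + cell_dist i y z).
Proof.
move=> [n [p [c [p0 pn hc ->]]]] iy iz.
exists n.+1, (fun k => if (k <= n)%N then p k else z),
  (fun k => if (k < n)%N then c k else i); split.
- by [].
- by rewrite /= ltnn.
- move=> k; rewrite ltnS leq_eqVlt /= => /predU1P[->|kn].
    by rewrite eqxx !ltnn pn.
  by rewrite kn orbT; exact: hc.
- rewrite big_ord_recr /= leqnn !ltnn pn; congr (_ + _).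
  by apply: eq_bigr => -[k kn] _ /=; rewrite (ltnW kn) kn.
Qed.

(** The points joined to x by a chain form a set that contains every closed cell
    it meets, and so does its complement; hence both are coherently open. *)
Lemma joined_connected : (forall x : X, exists i : cell_index C, cell i x) ->
  connected [set: X] -> forall x y : X, joined x y.
Proof.
move=> cov conn x y.
have jo i u v : cell i u -> cell i v -> joined x u -> joined x v.
  by move=> iu iv [l xl]; exists (l + cell_dist i u v); exact: chain_step.
suff /seteqP[_ /(_ y I)] : [set u : X | joined x u] = [set: X] by [].
apply: conn.
- exists x => /=; have [i ix] := cov x; exists 0; exists 0%N, (fun=> x), (fun=> i).
  by split=> //; rewrite big_ord0.
- exists [set u : X | joined x u]; last by rewrite setTI.
  have : @coherent_open R C [set u : X | joined x u].
    by move=> i u iu xu; exists 1 => // v iv _; exact: (jo i u).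
  by [].
- exists [set u : X | joined x u]; last by rewrite setTI.
  rewrite -openC.
  have : @coherent_open R C (~` [set u : X | joined x u]).
    by move=> i u iu xu; exists 1 => // v iv _ xv; apply: xu; exact: (jo i v u).
  by [].
Qed.

Lemma path_dist_chain (x y : X) e : joined x y -> path_dist x y < e ->
  exists2 l, chain_lengths x y l & l < e.
Proof.
move=> xy xye; apply: contrapT => h.
suff : e <= path_dist x y by rewrite leNgt xye.
apply: lb_le_inf => // l xl; rewrite leNgt; apply/negP => le.
by apply: h; exists l.
Qed.

Lemma path_dist_le_cell (x y : X) i : cell_dist_ge0 -> cell i x -> cell i y ->
  path_dist x y <= cell_dist i x y.
Proof.
move=> d0 ix iy; apply: ge_inf; last first.
  exists 1%N, (fun k => if k is 0%N then x else y), (fun=> i); split=> //.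
    by case.
  by rewrite big_ord1.
exists 0 => _ [n [p [c [_ _ hc ->]]]]; apply: sumr_ge0 => -[k kn] _ /=.
by have [] := hc _ kn; exact: d0.
Qed.

(** The bound M stops a chain before it can leave the chart. *)
Definition chart (E : choiceType) (M : R) (D : set X) (t : X -> E -> R) :=
  forall i x y, cell i x -> cell i y -> D x -> (forall w, t x w < M) ->
    D y /\ l2_le (t x) (t y) (cell_dist i x y).

(** Induction along a chain of length l < e <= r.  After each link the coordinates
    have moved by at most l, so they are still below M and the next link also
    stays in the chart; the l2-bounds add up. *)
Lemma chart_path_dist (E : choiceType) (M : R) D (t : X -> E -> R) r e (p y : X) :
  cell_dist_ge0 -> chart M D t -> joined p y ->
  D p -> (forall w, t p w <= M - r) -> e <= r -> path_dist p y < e ->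
  D y /\ l2_le (t p) (t y) e.
Proof.
move=> d0 ch jpy Dp tp er /path_dist_chain [//|l].
move=> [n [z [c [z0 zn hc ->]]]] le.
pose L k := \sum_(i < k) cell_dist (c i) (z i) (z i.+1).
have Lge0 k : (k <= n)%N -> 0 <= L k.
  move=> kn; apply: sumr_ge0 => -[i ik] _ /=.
  by have [] := hc _ (leq_trans ik kn); exact: d0.
have LS k : L k.+1 = L k + cell_dist (c k) (z k) (z k.+1).
  by rewrite /L big_ord_recr.
have Lmono k : (k < n)%N -> L k <= L k.+1.
  by move=> kn; rewrite LS lerDl; have [] := hc _ kn; exact: d0.
have Lle k : (k <= n)%N -> L k <= L n.
  move=> kn; rewrite -(subnKC kn).
  have : (k + (n - k) <= n)%N by rewrite subnKC.
  elim: (n - k)%N => [|j IH]; first by rewrite addn0.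
  rewrite addnS => kj; apply: le_trans (IH (ltnW kj)) (Lmono _ kj).
suff H k : (k <= n)%N -> D (z k) /\ l2_le (t p) (t (z k)) (L k).
  have [Dy ty] := H n (leqnn n).
  by rewrite -zn; split=> //; apply: l2_le_mono ty; rewrite ?Lge0 // ltW.
elim: k => [|k IH] kn.
  by rewrite z0; split=> //; exact: l2_le_refl.
have [Dk tk] := IH (ltnW kn); have [ck ck1] := hc _ kn.
have [w|Dk1 tk1] := ch _ _ _ ck ck1 Dk.
  have := l2_le_coord w (Lge0 _ (ltnW kn)) tk.
  have := tp w; have := Lle k (ltnW kn); move: le; rewrite -/(L n) ler_norml; lra.
split=> //; rewrite LS; apply: l2_le_triangle tk tk1; first exact/Lge0/ltnW.
exact: d0.
Qed.

Lemma converges_to_shift N (u : nat -> X) l :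
  converges_to (fun n => u (N + n)%N) l -> converges_to u l.
Proof.
move=> h e /h [N' HN']; exists (N + N')%N => n Nn.
have Nn' : (N <= n)%N by apply: leq_trans Nn; rewrite leq_addr.
by rewrite -(subnKC Nn'); apply: HN'; rewrite leq_subRL.
Qed.

(** The last two hypotheses on charts are the geometric input: a finitely supported
    limit vector is realised by a point, and coordinates that are jointly
    non-zero in arbitrarily large finite families yield ascending cells. *)
Lemma complete_of_charts (E : choiceType) (J : Type) (M r : R)
    (D : J -> set X) (t : J -> X -> E -> R) :
  cell_dist_ge0 -> (forall x y : X, joined x y) -> 0 < r ->
  (forall j, chart M (D j) (t j)) ->
  (forall p, exists2 j, D j p & forall w, t j p w <= M - r) ->
  (forall j (u : nat -> X) x, (forall n, D j (u n)) ->
     l2_cvg (fun n => t j (u n)) x -> finite_set [set w | x w != 0] ->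
     exists q, converges_to u q) ->
  (forall j (e : nat -> E), injective e ->
     (forall n, exists2 p, D j p & forall i, (i < n)%N -> t j p (e i) != 0) ->
     exists s : nat -> cell_index C, infinite_ascending s) ->
  ~ (exists s : nat -> cell_index C, infinite_ascending s) ->
  path_metric_complete C.
Proof.
move=> d0 jo r0 ch cov Hlim Hasc nasc u cu.
have r20 : 0 < r / 2 by lra.
(* Within r / 2 of u N the coordinates are at most M - r / 2, so that r / 2 is still
   an admissible radius around every late term. *)
have [N HN] := cu _ r20.
have [j Dj tj] := cov (u N).
have Du n : (N <= n)%N -> D j (u n) /\ forall w, t j (u n) w <= M - r / 2.
  move=> Nn.
  have lr : r / 2 <= r by lra.
  have [Dn tn] := chart_path_dist d0 (ch j) (jo _ _) Dj tj lr (HN _ _ (leqnn N) Nn).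
  split=> // w; have := l2_le_coord w (ltW r20) tn; have := tj w.
  rewrite ler_norml; lra.
pose v n := u (N + n)%N.
have Dv n : D j (v n) by have [] := Du _ (leq_addr n N).
have cv : l2_cauchy (fun n => t j (v n)).
  move=> e e0.
  have m0 : 0 < Num.min e (r / 2) by rewrite lt_min e0.
  have [N' HN'] := cu _ m0; exists N' => m n Nm Nn.
  have Nm' := leq_trans Nm (leq_addl N m).
  have Nn' := leq_trans Nn (leq_addl N n).
  have [_ tv] := Du _ (leq_addr m N).
  have lr : Num.min e (r / 2) <= r / 2 by rewrite ge_min lexx orbT.
  have [_] := chart_path_dist d0 (ch j) (jo _ _) (Dv m) tv lr (HN' _ _ Nm' Nn').
  by apply: l2_le_mono; rewrite ?ge_min ?lexx // ltW.
have [x vx] := l2_complete cv.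
have [fx|/infinite_set_inj[f finj xf]] := pselect (finite_set [set w | x w != 0]).
  have [q vq] := Hlim j v x Dv vx fx.
  by exists q; exact: converges_to_shift vq.
case: nasc; apply: (Hasc j f) => // n.
have xF w : w \in [seq f i | i <- iota 0 n] -> x w != 0.
  by move=> /mapP[i _ ->]; exact: xf.
have [N' HN'] := l2_cvg_neq0 vx xF.
exists (v N') => // i ni; apply: (HN' _ (leqnn _)).
by apply: map_f; rewrite mem_iota.
Qed.

(** Each coordinate e i is eventually constant along u, equal to a i <> 0; a limit
    point would inherit all these non-zero coordinates. *)
Lemma incomplete_of_chart (E : choiceType) (M r : R) (D : set X)
    (t : X -> E -> R) (u : nat -> X) (e : nat -> E) (a : nat -> R) :
  cell_dist_ge0 -> (forall x y : X, joined x y) -> 0 < r ->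
  chart M D t -> (forall x, D x -> finite_set [set w | t x w != 0]) ->
  (forall n, D (u n)) -> (forall n w, t (u n) w <= M - r) ->
  injective e -> (forall i, a i != 0) ->
  (forall i n, (i < n)%N -> t (u n) (e i) = a i) ->
  cauchy_sequence u -> ~ path_metric_complete C.
Proof.
move=> d0 jo r0 ch fin Du tu einj a0 ta cu /(_ _ cu)[l ul].
have [N HN] := ul _ r0.
have [Dl _] := chart_path_dist d0 ch (jo _ _) (Du N) (tu N) (lexx r) (HN _ (leqnn N)).
have tl i : t l (e i) != 0.
  have m0 : 0 < Num.min r (`|a i| / 2) by rewrite lt_min r0 divr_gt0 ?normr_gt0.
  have [N' HN'] := ul _ m0.
  have ler : Num.min r (`|a i| / 2) <= r by rewrite ge_min lexx.
  have [_] := chart_path_dist d0 ch (jo _ _) (Du (maxn N' i.+1)) (tu _) ler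
    (HN' _ (leq_maxl _ _)).
  move=> /(l2_le_coord (e i) (ltW m0)); rewrite ta ?leq_maxr // => h.
  apply/eqP => tl; move: h; rewrite tl subr0 le_min => /andP[_].
  by have : 0 < `|a i| by [rewrite normr_gt0]; lra.
apply: infinite_nat; apply: (@sub_finite_set _ _ (e @^-1` [set w | t l w != 0])).
  by move=> i _; exact: tl.
by apply: finite_preimage (fin _ Dl) => i j _ _; exact: einj.
Qed.

End CellSpace.

(** * Test vectors with finite support *)

Section Spread.
Variables (R : realType) (E : choiceType).
Implicit Types (e : nat -> E) (h : nat -> R).

(** For injective e, the vector with value h i at e i for i < n, and 0 elsewhere. *)
Definition spread e h n (w : E) : R := \sum_(i < n) h i * (w == e i)%:R.

Lemma spreadE e h n i : injective e -> (i < n)%N -> spread e h n (e i) = h i.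
Proof.
move=> einj lin; rewrite /spread (bigD1 (Ordinal lin)) //= eqxx mulr1.
rewrite big1 ?addr0 // => j ji; rewrite (inj_eq einj).
by case: eqP => [ij|]; rewrite ?mulr0 // -(inj_eq val_inj) /= ij eqxx in ji *.
Qed.

Lemma spreadE0 e h n i : injective e -> (n <= i)%N -> spread e h n (e i) = 0.
Proof.
move=> einj nli; rewrite /spread big1 // => j _; rewrite (inj_eq einj).
by rewrite gtn_eqF ?mulr0 // (leq_trans (ltn_ord j)).
Qed.

Lemma spread_neq0 e h n w : spread e h n w != 0 -> exists2 i, (i < n)%N & w = e i.
Proof.
move=> nz; apply: contrapT => H; move/eqP: nz; apply.
rewrite /spread big1 // => i _; case: eqP => [wi|]; rewrite ?mulr0 //.
by case: H; exists i.
Qed.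

Lemma spread_ge0 e h n w : (forall i, 0 <= h i) -> 0 <= spread e h n w.
Proof. by move=> h0; apply: sumr_ge0 => i _; rewrite mulr_ge0. Qed.

Lemma sum_half_tail m n : (m <= n)%N ->
  \sum_(m <= i < n) 2%:R ^- i.+1 = 2%:R ^- m - 2%:R ^- n :> R.
Proof.
move=> mn; rewrite -[RHS]opprB -(telescope_sumr (fun i => 2%:R ^- i : R) mn) -sumrN.
apply: eq_bigr => i _; rewrite exprS invfM.
by field; rewrite expf_neq0 ?pnatr_eq0.
Qed.

Lemma sum_half n : \sum_(i < n) 2%:R ^- i.+1 = 1 - 2%:R ^- n :> R.
Proof.
rewrite -(big_mkord xpredT (fun i => 2%:R ^- i.+1)).
by rewrite sum_half_tail // expr0 invr1.
Qed.

Lemma small_half (e : R) : 0 < e -> exists N, 2%:R ^- N < e.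
Proof.
move=> e0; exists (Num.bound e^-1).
rewrite invf_plt ?posrE ?exprn_gt0 //.
apply: lt_trans (archi_boundP _) _; first by rewrite invr_ge0 ltW.
by rewrite -natrX ltr_nat ltn_expl.
Qed.

End Spread.

(** * Chord and arc *)

Section Acos.
Variable R : realType.
Implicit Types x z : R.

Lemma sin_le_id x : 0 <= x -> sin x <= x.
Proof.
rewrite le_eqVlt => /predU1P[<-|x0]; first by rewrite sin0.
have [|c _] := @MVT R sin cos 0 x x0 (fun y _ => is_derive_sin y).
  by apply: continuous_subspaceT => y; exact: continuous_sin.
rewrite sin0 !subr0 => ->; rewrite ler_piMl ?cos_le1 //; exact: ltW.
Qed.

(** With a = acos z, the squared chord is 2 - 2 cos a = 4 sin(a/2)^2 <= a^2. *)
Lemma acos_chord z : -1 <= z <= 1 -> 2 - 2 * z <= acos z ^+ 2.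
Proof.
move=> hz; have [/andP[a0 api] cz] := acos_def hz.
set a := acos z in a0 api cz *; rewrite -cz.
have ha : 0 <= a / 2 by rewrite divr_ge0.
have -> : cos a = 1 - 2 * sin (a / 2) ^+ 2.
  have -> : a = a / 2 + a / 2 by field.
  rewrite cosD -!expr2 cos2sin2.
  have -> : (a / 2 + a / 2) / 2 = a / 2 by field.
  ring.
have s0 : 0 <= sin (a / 2) by apply: sin_ge0_pi; rewrite ha /=; lra.
have sa := sin_le_id ha.
have : sin (a / 2) ^+ 2 <= (a / 2) ^+ 2 by rewrite lerXn2r ?nnegrE.
nra.
Qed.

Lemma acos_small e : 0 < e -> exists2 d, 0 < d &
  forall z, z <= 1 -> 1 - d < z -> acos z < e.
Proof.
move=> e0; pose m := Num.min e pi.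
have m0 : 0 < m by rewrite lt_min e0 pi_gt0.
have mpi : m <= pi by rewrite ge_min lexx orbT.
exists (1 - cos m).
  rewrite subr_gt0 -[X in _ < X]cos0 ltr_cos // in_itv /= ?lexx ?pi_ge0 //.
  by rewrite mpi ltW.
move=> z z1; rewrite opprB addrC subrK => mz.
have zN1 : -1 <= z by apply: le_trans (ltW mz); rewrite cos_geN1.
have hz : -1 <= z <= 1 by rewrite zN1.
apply: (@lt_le_trans _ _ m); last by rewrite ge_min lexx.
rewrite ltNge; apply/negP => ma; have [/andP[a0 api] cz] := acos_def hz.
move: mz; rewrite -cz ltr_cos ?in_itv /= ?a0 ?api ?mpi ?(ltW m0) //.
by rewrite ltNge ma.
Qed.

End Acos.

(** * Simplicial complexes *)

Section Simplicial.
Variables (R : realType) (K : simplicial_complex).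
Local Notation C := (all_right R K).
Local Notation X := (carrier C).
Local Notation supp x := (finsupp (sval (x : realization R K))).

Definition vcoord (x : X) : vertex K -> R := fun v => sval x v.

Lemma vcoord_ge0 x v : 0 <= vcoord x v.
Proof. by case: x => x [sx x0 x1]; exact: x0. Qed.

Lemma vcoord_simplex x : simplex (supp x).
Proof. by case: x => x []. Qed.

Lemma vcoord_cell (s : cell_index C) x v : cell s x -> vcoord x v != 0 -> v \in sval s.
Proof. by move=> /= /fsubsetP sx xv; apply: sx; rewrite mem_finsupp. Qed.

Lemma in_cell (s : cell_index C) x :
  (forall v, vcoord x v != 0 -> v \in sval s) -> cell s x.
Proof. by move=> h; apply/fsubsetP => v; rewrite mem_finsupp; exact: h. Qed.

Lemma sum_vcoord_sq (F : seq (vertex K)) x : uniq F ->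
  (forall v, vcoord x v != 0 -> v \in F) -> \sum_(v <- F) vcoord x v ^+ 2 = 1.
Proof.
case: x => x [sx x0 x1] uF xF; rewrite -[RHS]x1 /vcoord /=; apply: le_anti.
apply/andP; split; apply: sum_sub_le; rewrite ?fset_uniq // => v; rewrite ?sqr_ge0 //.
  by rewrite sqrf_eq0 mem_finsupp.
by rewrite sqrf_eq0; exact: xF.
Qed.

Lemma sum_vcoord_le1 (F : seq (vertex K)) x : uniq F -> \sum_(v <- F) vcoord x v ^+ 2 <= 1.
Proof.
move=> uF; rewrite -(@sum_vcoord_sq (supp x) x) ?fset_uniq //; last first.
  by move=> v; rewrite mem_finsupp.
apply: sum_sub_le => // v; rewrite ?sqr_ge0 // sqrf_eq0 mem_finsupp //.
Qed.

Lemma vcoord_le1 x v : vcoord x v <= 1.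
Proof.
have := @sum_vcoord_le1 [:: v] x isT; rewrite big_seq1.
by rewrite expr_le1 // vcoord_ge0.
Qed.

Lemma vcoord_l2 x : l2_le (vcoord x) (fun=> 0) 1.
Proof.
by move=> F uF; under eq_bigr do rewrite subr0; rewrite expr1n; exact: sum_vcoord_le1.
Qed.

(** Points of a simplex are unit vectors, so the chord is determined by the inner
    product, hence by the angle. *)
Lemma chord_sq (s : cell_index C) x y : cell s x -> cell s y ->
  \sum_(v <- sval s) (vcoord x v - vcoord y v) ^+ 2 =
  2 - 2 * \sum_(v <- sval s) vcoord x v * vcoord y v.
Proof.
move=> sx sy.
have -> : 2 - 2 * \sum_(v <- sval s) vcoord x v * vcoord y v =
  \sum_(v <- sval s) vcoord x v ^+ 2 + \sum_(v <- sval s) vcoord y v ^+ 2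
   - 2 * \sum_(v <- sval s) vcoord x v * vcoord y v.
  by rewrite !sum_vcoord_sq ?fset_uniq // => v; exact: vcoord_cell.
rewrite mulr_sumr -sumrN -!big_split /=; apply: eq_bigr => v _; ring.
Qed.

Lemma dot_bounds (s : cell_index C) x y : cell s x -> cell s y ->
  -1 <= \sum_(v <- sval s) vcoord x v * vcoord y v <= 1.
Proof.
move=> sx sy; apply/andP; split.
  apply: (@le_trans _ _ 0); first by rewrite lerN10.
  by apply: sumr_ge0 => v _; rewrite mulr_ge0 ?vcoord_ge0.
have : 0 <= \sum_(v <- sval s) (vcoord x v - vcoord y v) ^+ 2.
  by apply: sumr_ge0 => v _; rewrite sqr_ge0.
rewrite chord_sq //; lra.
Qed.

Lemma angular_ge0 : cell_dist_ge0 C.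
Proof. by move=> s x y sx sy; apply: acos_ge0; exact: dot_bounds. Qed.

Lemma vcoord_chart : chart 2 [set: X] vcoord.
Proof.
move=> s x y sx sy _ _; split=> // F uF.
apply: le_trans (acos_chord (dot_bounds sx sy)).
rewrite -chord_sq //; apply: sum_sub_le => // v; rewrite ?sqr_ge0 // sqrf_eq0 subr_eq0.
apply: contraR => vs.
have -> : vcoord x v = 0 by apply/eqP; apply: contraR vs; exact: vcoord_cell.
by apply/eqP/esym/eqP; apply: contraR vs; exact: vcoord_cell.
Qed.

Lemma vcoord_point (s : {fset vertex K}) (g : vertex K -> R) : simplex s ->
  (forall v, 0 <= g v) -> (forall v, g v != 0 -> v \in s) ->
  \sum_(v <- s) g v ^+ 2 = 1 -> exists x, vcoord x = g.
Proof.
move=> ss g0 gs g1.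
pose x : {fsfun vertex K -> R with 0} := [fsfun v in s => g v | 0].
have xE v : x v = g v.
  by rewrite fsfunE; case: ifPn => // vs; apply/esym/eqP; apply: contraR vs; exact: gs.
have xs : (finsupp x `<=` s)%fset.
  by apply/fsubsetP => v; rewrite mem_finsupp xE; exact: gs.
have x1 : \sum_(v <- finsupp x) x v ^+ 2 = 1.
  rewrite -g1; apply: le_anti; apply/andP; split.
    under eq_bigr do rewrite xE.
    apply: sum_sub_le; rewrite ?fset_uniq // => v; rewrite ?sqr_ge0 // sqrf_eq0.
    exact: gs.
  under [X in _ <= X]eq_bigr do rewrite xE.
  apply: sum_sub_le; rewrite ?fset_uniq // => v; rewrite ?sqr_ge0 // sqrf_eq0.
  by rewrite mem_finsupp xE.
have sx : simplex (finsupp x).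
  apply: simplex_face ss xs _; apply: contraTneq (oner_neq0 R) => x0.
  by rewrite -x1 x0 big_seq_fset0 eqxx.
have x0 v : 0 <= x v by rewrite xE.
by exists (exist _ x (And3 sx x0 x1)); apply/funext => v; exact: xE.
Qed.

Lemma vertex_point (v : vertex K) : exists x, vcoord x = (fun w => (w == v)%:R).
Proof.
apply: (@vcoord_point [fset v]%fset); first exact: simplex_vertex.
- by move=> w; rewrite ler0n.
- by move=> w; rewrite inE; case: (w == v); rewrite ?eqxx.
- by rewrite big_seq_fset1 eqxx expr1n.
Qed.

Lemma simplicial_covered (x : X) : exists s : cell_index C, cell s x.
Proof.
by exists (exist _ _ (vcoord_simplex x)); apply: in_cell => v; rewrite mem_finsupp.
Qed.

(** The l2-limit of unit vectors has norm 1.  Its finite support is a face of the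
    support of every late term, so the limit is a point of a common simplex, where
    a small chord means a small angle. *)
Lemma simplicial_limit (u : nat -> X) x : l2_cvg (fun n => vcoord (u n)) x ->
  finite_set [set w | x w != 0] -> exists q, converges_to u q.
Proof.
move=> ux fx; pose S := fset_set [set w | x w != 0].
have SE v : (v \in S) = (x v != 0).
  by rewrite in_fset_set //; apply/idP/idP; rewrite inE.
have x0 := l2_cvg_ge0 ux (fun n => vcoord_ge0 (u n)).
pose A := \sum_(v <- S) x v ^+ 2.
have A0 : 0 <= A by apply: sumr_ge0 => v _; exact: sqr_ge0.
have xA : l2_le x (fun=> 0) (Num.sqrt A).
  move=> F uF; under eq_bigr do rewrite subr0; rewrite sqr_sqrtr //.
  by apply: sum_sub_le => // v; rewrite ?sqr_ge0 // sqrf_eq0 SE.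
(* By the triangle inequality the norm of x is within e of the norm 1 of u N. *)
have A1 : Num.sqrt A = 1.
  apply: le_anti; apply/andP; split; apply/ler_addgt0Pr => e e0;
    have [N /(_ _ (leqnn N)) uxN] := ux _ e0.
    have := l2_le_triangle (ltW e0) ler01 (l2_le_sym uxN) (@vcoord_l2 (u N)).
    move=> /(_ S (fset_uniq _)); under eq_bigr do rewrite subr0.
    rewrite -/A -{1}(sqr_sqrtr A0).
    by rewrite ler_pXn2r ?nnegrE ?addr_ge0 ?sqrtr_ge0 ?(ltW e0) // addrC.
  have := l2_le_triangle (ltW e0) (sqrtr_ge0 A) uxN xA.
  move=> /(_ _ (fset_uniq (supp (u N)))).
  under eq_bigr do rewrite subr0; rewrite sum_vcoord_sq ?fset_uniq //; last first.
    by move=> v; rewrite mem_finsupp.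
  rewrite -[X in X <= _](expr1n _ 2).
  by rewrite ler_pXn2r ?nnegrE ?addr_ge0 ?sqrtr_ge0 ?(ltW e0) // addrC.
have {}A1 : A = 1 by rewrite -(sqr_sqrtr A0) A1 expr1n.
have [|N HN] := l2_cvg_neq0 ux (F := S); first by move=> w; rewrite SE.
have SuN n : (N <= n)%N -> (S `<=` supp (u n))%fset.
  by move=> Nn; apply/fsubsetP => v vS; rewrite mem_finsupp; exact: HN.
have sS : simplex S.
  apply: simplex_face (vcoord_simplex (u N)) (SuN _ (leqnn N)) _.
  by apply: contraTneq (oner_neq0 R) => S0; rewrite -A1 /A S0 big_seq_fset0 eqxx.
have [|q qx] := vcoord_point sS x0 _ A1; first by move=> v; rewrite SE.
exists q => eta eta0; have [d d0 Hd] := acos_small eta0.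
have e0 : 0 < Num.min 1 d by rewrite lt_min ltr01.
have [N' HN'] := ux _ e0; exists (maxn N N') => n; rewrite geq_max => /andP[Nn N'n].
pose s : cell_index C := exist _ _ (vcoord_simplex (u n)).
have su : cell s (u n) by apply: in_cell => v; rewrite mem_finsupp.
have sq : cell s q.
  apply: in_cell => v; rewrite qx -SE; exact: (fsubsetP (SuN _ Nn)).
apply: le_lt_trans (path_dist_le_cell angular_ge0 su sq) _.
apply: Hd; first by have /andP[] := dot_bounds su sq.
have := HN' n N'n (sval s) (fset_uniq _); rewrite -qx chord_sq // => H.
have : (Num.min 1 d) ^+ 2 <= d.
  rewrite expr2 (@le_trans _ _ (1 * Num.min 1 d)) ?ler_wpM2r ?(ltW e0) ?ge_min ?lexx //.
  by rewrite mul1r ge_min lexx orbT.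
by move: H; rewrite /vcoord; lra.
Qed.

Lemma simplicial_ascending (e : nat -> vertex K) : injective e ->
  (forall n, exists2 p : X, True & forall i, (i < n)%N -> vcoord p (e i) != 0) ->
  exists s : nat -> cell_index C, infinite_ascending s.
Proof.
move=> einj He; pose F n : {fset vertex K} := seq_fset tt [seq e i | i <- iota 0 n.+1].
have FE n i : (e i \in F n) = (i <= n)%N.
  by rewrite seq_fsetE (mem_map einj) mem_iota.
have FP n v : v \in F n -> exists2 i, (i <= n)%N & v = e i.
  by rewrite seq_fsetE => /mapP[i]; rewrite mem_iota => /andP[_ h] ->; exists i.
have sF n : simplex (F n).
  have [p _ pe] := He n.+1; apply: simplex_face (vcoord_simplex p) _ _.
    by apply/fsubsetP => v /FP[i lin ->]; rewrite mem_finsupp; exact: pe.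
  by apply/fset0Pn; exists (e 0%N); rewrite FE.
exists (fun n => exist _ _ (sF n)) => n; split.
  move=> x xn; apply: in_cell => v xv; have /= /FP[i lin ->] := vcoord_cell xn xv.
  by rewrite FE ltnW.
have [x xe] := vertex_point (e n.+1) => /(_ x) H.
have : e n.+1 \in F n.
  apply: (vcoord_cell (H _)); last by rewrite xe eqxx oner_neq0.
  apply: in_cell => v; rewrite xe; have [-> _|_] := eqVneq v; last by rewrite eqxx.
  by rewrite FE.
by rewrite FE ltnn.
Qed.

(** With v_n a vertex of the (n+1)-st simplex outside the n-th one, the point u_n
    has squared coordinates 1/2, 1/4, ..., 2^-n along v_0, ..., v_(n-1), and the
    remaining mass 2^-n along v_n, which makes it a unit vector.  The inner product of
    u_m and u_n is at least 1 - 2^-N for m, n >= N. *)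
Lemma simplicial_incomplete (s : nat -> cell_index C) :
  connected [set: X] -> infinite_ascending s -> ~ path_metric_complete C.
Proof.
move=> conn asc.
have ss n : {subset sval (s n) <= sval (s n.+1)}.
  move=> v vs; have [x xv] := vertex_point v; have [sub _] := asc n.
  apply: (vcoord_cell (sub x _)); last by rewrite xv eqxx oner_neq0.
  by apply: in_cell => w; rewrite xv; have [->|_] := eqVneq w; rewrite ?eqxx.
have smono m n : (m <= n)%N -> {subset sval (s m) <= sval (s n)}.
  move=> /subnKC <-; elim: (n - m)%N => [|k IH] v; first by rewrite addn0.
  by rewrite addnS => /IH /ss.
have /choice[e eP] n : exists v, v \in sval (s n.+1) /\ v \notin sval (s n).
  have [_ nsub] := asc n; apply: contrapT => H; apply: nsub => x xn.
  apply: in_cell => v xv; apply: contrapT => vs; apply: H; exists v.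
  by split; [exact: vcoord_cell xn xv | exact/negP].
have es i n : (i < n)%N -> e i \in sval (s n).
  by move=> lin; apply: (smono _ _ lin); case: (eP i).
have einj : injective e.
  have lt_neq i j : (i < j)%N -> e i <> e j.
    by move=> ij eij; have [_ /negP[]] := eP j; rewrite -eij; exact: es.
  by move=> i j eij; case: (ltngtP i j) => // /lt_neq; rewrite eij.
pose b i : R := Num.sqrt (2%:R ^- i.+1).
pose h n i : R := if (i < n)%N then b i else Num.sqrt (2%:R ^- n).
have half0 n : 0 < 2%:R ^- n :> R by rewrite invr_gt0 exprn_gt0.
have h0 n i : 0 <= h n i by rewrite /h; case: ifP => _; exact: sqrtr_ge0.
have g0 n v := spread_ge0 e n.+1 v (h0 n).
have gs n v : spread e (h n) n.+1 v != 0 -> v \in sval (s n.+1).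
  by move=> /spread_neq0[i lin ->]; exact: es.
have g1 n : \sum_(v <- sval (s n.+1)) spread e (h n) n.+1 v ^+ 2 = 1.
  have -> : \sum_(v <- sval (s n.+1)) spread e (h n) n.+1 v ^+ 2 =
    \sum_(v <- [seq e i | i <- index_iota 0 n.+1]) spread e (h n) n.+1 v ^+ 2.
    apply: le_anti; apply/andP; split; apply: sum_sub_le;
      rewrite ?fset_uniq ?map_inj_uniq ?iota_uniq // => v; rewrite ?sqr_ge0 // sqrf_eq0.
      by move=> /spread_neq0[i lin ->]; rewrite map_f // mem_index_iota.
    exact: gs.
  rewrite big_map big_mkord big_ord_recr /= spreadE // /h ltnn sqr_sqrtr ?ltW //.
  rewrite (eq_bigr (fun i : 'I_n => 2%:R ^- i.+1)) ?sum_half ?subrK //.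
  move=> i _; rewrite spreadE ?(ltn_ord i) ?sqr_sqrtr ?ltW //.
  exact: ltnW (ltn_ord i).
have /choice[u uE] n : exists x, vcoord x = spread e (h n) n.+1.
  exact: (vcoord_point (svalP (s n.+1)) (g0 n) (gs n) (g1 n)).
have jo := joined_connected simplicial_covered conn.
have r0 : 0 < 1 :> R by [].
have b_neq0 i : b i != 0 by rewrite gt_eqF // sqrtr_gt0.
have ub i n : (i < n)%N -> vcoord (u n) (e i) = b i.
  by move=> lin; rewrite uE spreadE ?/h ?lin //; exact: ltnW.
apply: (incomplete_of_chart angular_ge0 jo r0 vcoord_chart _ _ _ einj b_neq0 ub) => //.
- move=> x _; apply: (@sub_finite_set _ _ [set` supp x]) => [v|].
    by rewrite /= mem_finsupp.
  exact: finite_fset.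
- move=> n w; have := vcoord_le1 (u n) w; lra.
move=> eta eta0; have [d d0 Hd] := acos_small eta0.
have [N HN] := small_half d0; exists N => m n Nm Nn.
pose k := (maxn m n).+1.
have sm : cell (s k) (u m).
  apply: in_cell => v; rewrite uE => /gs; apply: smono; by rewrite ltnS leq_maxl.
have sn : cell (s k) (u n).
  apply: in_cell => v; rewrite uE => /gs; apply: smono; by rewrite ltnS leq_maxr.
apply: le_lt_trans (path_dist_le_cell angular_ge0 sm sn) _.
apply: Hd; first by have /andP[] := dot_bounds sm sn.
apply: (@lt_le_trans _ _ (1 - 2%:R ^- N)); first by rewrite ltrD2l ltrN2.
rewrite -sum_half.
have -> : \sum_(i < N) 2%:R ^- i.+1 =
  \sum_(v <- [seq e i | i <- index_iota 0 N]) vcoord (u m) v * vcoord (u n) v.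
  rewrite big_map big_mkord; apply: eq_bigr => i _.
  have iN := ltn_ord i.
  by rewrite !ub ?(leq_trans iN) // -expr2 sqr_sqrtr // ltW.
apply: sum_sub_le.
- by rewrite map_inj_uniq ?iota_uniq.
- by move=> v; rewrite mulr_ge0 ?vcoord_ge0.
- by move=> v; rewrite mulf_eq0 negb_or => /andP[xv _]; exact: vcoord_cell sm xv.
Qed.

Lemma simplicial_complete : connected [set: X] ->
  ~ (exists s : nat -> cell_index C, infinite_ascending s) -> path_metric_complete C.
Proof.
move=> conn nasc; have jo := joined_connected simplicial_covered conn.
have r0 : 0 < 1 :> R by [].
refine (@complete_of_charts _ C (vertex K) unit 2 1 (fun=> setT) (fun=> vcoord)
  angular_ge0 jo r0 _ _ _ _ nasc).
- by move=> _; exact: vcoord_chart.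
- by move=> p; exists tt => // w; have := vcoord_le1 p w; lra.
- by move=> _ u x _; exact: simplicial_limit.
- by move=> _; exact: simplicial_ascending.
Qed.

End Simplicial.

(** * Corners of the unit cube *)

Section Corner.
Variables (R : realType) (n : nat).
Implicit Types u v w : 'rV[R]_n.

Definition corner u := forall i, u 0 i = 0 \/ u 0 i = 1.

Definition flip u i : 'rV[R]_n := \row_j if j == i then 1 - u 0 j else u 0 j.

Lemma flipE u i j : flip u i 0 j = if j == i then 1 - u 0 j else u 0 j.
Proof. by rewrite mxE. Qed.

Lemma corner_flip u i : corner u -> corner (flip u i).
Proof.
move=> cu j; rewrite flipE; case: (cu j) => ->; case: eqP => _;
  rewrite ?subr0 ?subrr; by [left|right].
Qed.

Lemma corner_unit_cube u : corner u -> unit_cube u.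
Proof. by move=> cu j; case: (cu j) => ->; rewrite ?lexx ?ler01. Qed.

Lemma flip_inj u : corner u -> injective (flip u).
Proof.
move=> cu i j /(congr1 (fun v : 'rV_n => v 0 i)); rewrite !flipE eqxx.
by have [//|_] := eqVneq i j; case: (cu i) => -> h; exfalso; lra.
Qed.

Lemma euclidean_sq u v : euclidean_dist u v ^+ 2 = \sum_i (u 0 i - v 0 i) ^+ 2.
Proof. by rewrite sqr_sqrtr // sumr_ge0 // => i _; exact: sqr_ge0. Qed.

Lemma euclidean_ge0 u v : 0 <= euclidean_dist u v.
Proof. exact: sqrtr_ge0. Qed.

(** The coordinate of v along the edge from the corner u to [flip u i] depends only
    on the distances of v to both ends of this edge; so it is preserved by isometric
    gluing. *)
Lemma corner_dist_coord u v i : corner u -> unit_cube v ->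
  2 * `|v 0 i - u 0 i| =
  1 + euclidean_dist v u ^+ 2 - euclidean_dist v (flip u i) ^+ 2.
Proof.
move=> cu qv; rewrite !euclidean_sq -addrA -sumrN -big_split /=.
rewrite (bigD1 i) //= big1 ?addr0; last first.
  by move=> j /negPf ji; rewrite flipE ji subrr.
rewrite flipE eqxx; have /andP[v0 v1] := qv i.
case: (cu i) => ->; first by rewrite !subr0 ger0_norm //; ring.
rewrite ler0_norm ?subr_le0 //; ring.
Qed.

Lemma corner_adjacent u v : corner u -> corner v ->
  euclidean_dist u v ^+ 2 = 1 -> exists i, v = flip u i.
Proof.
move=> cu cv; rewrite euclidean_sq => uv1.
have sq01 i : (u 0 i - v 0 i) ^+ 2 = (u 0 i != v 0 i)%:R.
  case: (cu i) => ->; case: (cv i) => ->; rewrite ?eqxx ?subrr ?expr0n //.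
    by rewrite eq_sym oner_neq0 sub0r sqrrN expr1n.
  by rewrite oner_neq0 subr0 expr1n.
have [i ui] : exists i, u 0 i != v 0 i.
  apply: contrapT => H; move: uv1; rewrite big1 => [/esym/eqP|i _].
    by rewrite oner_eq0.
  by rewrite sq01; case: eqP => // /eqP h; case: H; exists i.
exists i; apply/rowP => j; rewrite flipE.
move: uv1; rewrite (bigD1 i) //= sq01 ui -[X in _ = X]addr0 => /addrI s0.
case: eqP => [->|/eqP ji].
  by move: ui; case: (cu i) => ->; case: (cv i) => ->; rewrite ?eqxx // ?subr0 ?subrr.
move/eqP: s0; rewrite psumr_eq0 => [/allP/(_ j)|k _]; last exact: sqr_ge0.
rewrite mem_index_enum ji sq01 => /(_ isT) /=.
by have [//|_] := eqVneq (u 0 j) (v 0 j); rewrite oner_eq0.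
Qed.

(** The directions from a corner into the cube make angles at most pi / 2. *)
Lemma corner_extreme u v w : corner u -> unit_cube v -> unit_cube w ->
  euclidean_dist v w ^+ 2 <= euclidean_dist v u ^+ 2 + euclidean_dist w u ^+ 2.
Proof.
move=> cu qv qw; rewrite !euclidean_sq -big_split /=; apply: ler_sum => i _.
have := qv i; have := qw i; case: (cu i) => ->; move: (v 0 i) (w 0 i) => a b; nra.
Qed.

End Corner.

(** * Cubical complexes *)

Section CubeCoord.
Variables (R : realType) (K : cubical_complex R).
Local Notation C := (cubical_cells K).
Local Notation X := (carrier C).
Implicit Types (x y V w : X) (c : cube K).

Definition in_cube c x := exists2 u, unit_cube u & @cube_map R K c u = x.

Local Notation cmap c u := (@cube_map R K c u).
Local Notation co c x := (@cube_coord R K c x).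
Local Notation dist c x y := (euclidean_dist (co c x) (co c y)).

Lemma co_unit c x : in_cube c x -> unit_cube (co c x).
Proof.
by case=> u qu ux; have [] := @xgetPex _ 0 [set u | unit_cube u /\ cmap c u = x]
  (ex_intro _ u (conj qu ux)).
Qed.

Lemma coE c x : in_cube c x -> cmap c (co c x) = x.
Proof.
by case=> u qu ux; have [] := @xgetPex _ 0 [set u | unit_cube u /\ cmap c u = x]
  (ex_intro _ u (conj qu ux)).
Qed.

Lemma in_cube_map c u : unit_cube u -> in_cube c (cmap c u).
Proof. by exists u. Qed.

Lemma coK c u : unit_cube u -> co c (cmap c u) = u.
Proof.
move=> qu; have icu := in_cube_map qu.
by apply: cube_map_inj (coE icu) => //; exact: co_unit.
Qed.

Lemma cubical_cellE c f x :
  cell (existT _ c f : cell_index C) x <-> in_cube c x /\ cube_face f (co c x).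
Proof.
split=> [[u fu <-]|[cx fx]]; last by exists (co c x) => //; exact: coE.
by have [qu _] := fu; rewrite coK //; split=> //; exact: in_cube_map.
Qed.

(** What the gluing axiom says without naming the isometry: membership in the
    intersection is a face condition in either cube, and both cubes measure the
    same distances on it. *)
Lemma glue c c' V : in_cube c V -> in_cube c' V ->
  exists (f : 'I_(cube_dim c) -> option bool) (f' : 'I_(cube_dim c') -> option bool),
  [/\ forall x, in_cube c x -> (in_cube c' x <-> cube_face f (co c x)),
      forall x, in_cube c' x -> (in_cube c x <-> cube_face f' (co c' x)) &
      forall x y, in_cube c x -> in_cube c' x -> in_cube c y -> in_cube c' y ->
        dist c x y = dist c' x y].
Proof.
move=> cV c'V.
have [|f [f' [h [hf iso gl]]]] := @cube_map_glue R K c c'.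
  by exists V; split; [exists (co c V)|exists (co c' V)]; rewrite ?coE //; exact: co_unit.
have hunit u : cube_face f u -> unit_cube (h u).
  by move=> fu; have : (h @` cube_face f) (h u) by [exists u]; rewrite hf => -[].
have both x : in_cube c x -> in_cube c' x -> cube_face f (co c x) /\ co c' x = h (co c x).
  move=> cx c'x; apply/gl; rewrite ?coE //; exact: co_unit.
exists f, f'; split.
- move=> x cx; split=> [c'x|fx]; first by have [] := both x cx c'x.
  exists (h (co c x)); first exact: hunit.
  rewrite -[RHS](coE cx); apply/esym; apply/gl => //; first exact: co_unit.
  exact: hunit.
- move=> x c'x; split=> [cx|].
    by rewrite -hf; have [fx ->] := both x cx c'x; exists (co c x).
  rewrite -hf => -[u fu hu]; exists u; first by case: fu.
  rewrite -[RHS](coE c'x); apply/gl => //; [by case: fu|exact: co_unit].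
- move=> x y cx c'x cy c'y.
  have [fx ->] := both x cx c'x; have [fy ->] := both y cy c'y.
  by rewrite iso.
Qed.

Lemma dist_indep c c' x y : in_cube c x -> in_cube c' x -> in_cube c y -> in_cube c' y ->
  dist c x y = dist c' x y.
Proof. by move=> cx c'x cy c'y; have [f [f' [_ _]]] := glue cx c'x; apply. Qed.

(** If V is not a corner in c', it is the midpoint of a segment of c' parallel to a
    free direction of the common face.  The segment then lies in c as well, with the
    same distances, contradicting [corner_extreme] at the corner V of c. *)
Lemma corner_indep c c' V : in_cube c V -> in_cube c' V ->
  corner (co c V) -> corner (co c' V).
Proof.
move=> cV c'V kV i; have [f [f' [ff ff' dd]]] := glue cV c'V.
have /andP[v0 v1] := co_unit c'V i.
have [-> |vN0] := eqVneq (co c' V 0 i) 0; first by left.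
have [-> |vN1] := eqVneq (co c' V 0 i) 1; first by right.
have {vN0}v0 : 0 < co c' V 0 i by rewrite lt_neqAle eq_sym vN0.
have {vN1}v1 : co c' V 0 i < 1 by rewrite lt_neqAle vN1.
(* m 1 and m (-1) are the points of c' at distance e from V in direction i. *)
exfalso; pose v := co c' V.
pose e := Num.min (v 0 i) (1 - v 0 i).
have e0 : 0 < e by rewrite lt_min v0 subr_gt0.
have ev : e <= v 0 i by rewrite ge_min lexx.
have e1v : e <= 1 - v 0 i by rewrite ge_min lexx orbT.
pose m s : 'rV[R]_(cube_dim c') := \row_j if j == i then v 0 j + s * e else v 0 j.
have mE s j : m s 0 j = if j == i then v 0 j + s * e else v 0 j by rewrite mxE.
have fv : cube_face f' v by apply/ff'.
have f'i : f' i = None.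
  case fi : (f' i) => [b|//]; case: fv => _ /(_ _ _ fi) vi.
  by move: v0 v1; rewrite -/v vi; case: b {fi vi} => /=; rewrite ?ltxx.
have qm s : -1 <= s <= 1 -> unit_cube (m s).
  move=> /andP[s0 s1] j; rewrite mE; case: eqP => [->|_]; last exact: (co_unit c'V).
  by apply/andP; split; nra.
have fm s : -1 <= s <= 1 -> cube_face f' (m s).
  move=> hs; split=> [|j b fj]; first exact: qm.
  rewrite mE; case: eqP => [ji|_]; last by case: fv => _; exact.
  by rewrite ji f'i in fj.
have hp : -1 <= (1 : R) <= 1 by apply/andP; split; lra.
have hm : -1 <= (-1 : R) <= 1 by apply/andP; split; lra.
pose P := cmap c' (m 1); pose N := cmap c' (m (-1)).
have c'P : in_cube c' P by apply: in_cube_map; exact: qm.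
have c'N : in_cube c' N by apply: in_cube_map; exact: qm.
have cP : in_cube c P by apply/ff' => //; rewrite coK; [exact: fm|exact: qm].
have cN : in_cube c N by apply/ff' => //; rewrite coK; [exact: fm|exact: qm].
have := corner_extreme kV (co_unit cP) (co_unit cN).
rewrite !(dd _ _ cP c'P cN c'N) !(dd _ _ cP c'P cV c'V) !(dd _ _ cN c'N cV c'V).
rewrite !coK; [|exact: qm|exact: qm].
have single (p q : 'rV[R]_(cube_dim c')) : (forall j, j != i -> p 0 j = q 0 j) ->
    euclidean_dist p q ^+ 2 = (p 0 i - q 0 i) ^+ 2.
  move=> pq; rewrite euclidean_sq (bigD1 i) //= big1 ?addr0 // => j ji.
  by rewrite pq // subrr expr0n.
rewrite !single => [|j /negPf ji|j /negPf ji|j /negPf ji]; rewrite ?mE ?ji // eqxx -/v.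
nra.
Qed.

Lemma face_flip c (f : 'I_(cube_dim c) -> option bool) (u : 'rV[R]_(cube_dim c)) i :
  corner u -> cube_face f u -> (forall b, f i <> Some b) -> cube_face f (flip u i).
Proof.
move=> ku [_ fu] fi; split; first exact/corner_unit_cube/corner_flip.
move=> j b fj; rewrite flipE; case: eqP => [ji|_]; last exact: fu.
by case: (fi b); rewrite -ji.
Qed.

(** The other end of the i-th edge at V in the cube c. *)
Definition nb c V i : X := cmap c (flip (co c V) i).

Arguments nb : clear implicits.

Definition star V : set X := [set x | exists2 c, in_cube c V & in_cube c x].

(** The cube c is immaterial by [star_coordE]; the value is 0 at labels w that are
    not neighbours of V in a common cube with x. *)
Definition star_coord V x w : R :=
  xget 0 [set r | exists c i, [/\ in_cube c V, in_cube c x, w = nb c V i &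
                                  r = `|co c x 0 i - co c V 0 i|]].

Definition is_corner V := exists2 c, in_cube c V & corner (co c V).

Section Star.
Variables (V : X) (HV : is_corner V).
Local Notation t := (star_coord V).

Lemma cornerV c : in_cube c V -> corner (co c V).
Proof. by have [c' c'V kV] := HV => cV; exact: corner_indep kV. Qed.

Lemma nb_unit c i : in_cube c V -> unit_cube (flip (co c V) i).
Proof. by move=> cV; apply/corner_unit_cube/corner_flip/cornerV. Qed.

Lemma nb_in c i : in_cube c V -> in_cube c (nb c V i).
Proof. by move=> cV; apply/in_cube_map/nb_unit. Qed.

Lemma co_nb c i : in_cube c V -> co c (nb c V i) = flip (co c V) i.
Proof. by move=> cV; rewrite coK //; exact: nb_unit. Qed.

Lemma nb_inj c : in_cube c V -> injective (nb c V).
Proof.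
move=> cV i j /(congr1 (cube_coord c)); rewrite !co_nb //.
exact/flip_inj/cornerV.
Qed.

(** Two cubes containing V, x and the neighbour agree on the three distances that
    determine the coordinate. *)
Lemma star_coordE c x i : in_cube c V -> in_cube c x ->
  t x (nb c V i) = `|co c x 0 i - co c V 0 i|.
Proof.
move=> cV cx; rewrite /star_coord.
have [|c' [i' [c'V c'x w ->]]] := @xgetPex R 0 [set r | exists c' i',
    [/\ in_cube c' V, in_cube c' x, nb c V i = nb c' V i' &
        r = `|co c' x 0 i' - co c' V 0 i'|]].
  by exists `|co c x 0 i - co c V 0 i|, c, i.
apply: (mulfI (x := 2)); first by rewrite pnatr_eq0.
rewrite !corner_dist_coord; try exact: cornerV; try exact: co_unit.
rewrite -(co_nb i cV) -(co_nb i' c'V) -w.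
have cw := nb_in i cV; have c'w : in_cube c' (nb c V i) by rewrite w; exact: nb_in.
by rewrite (dist_indep c'x cx c'V cV) (dist_indep c'x cx c'w cw).
Qed.

(** A non-zero coordinate is witnessed in some cube c'.  The common face of c and c'
    contains V and x, which differ in direction i, so this direction is free in
    the face and the neighbour w lies in c too.  There it is a corner at distance 1
    from V. *)
Lemma star_coord_nb c x w : in_cube c V -> in_cube c x -> t x w != 0 ->
  exists i, w = nb c V i.
Proof.
move=> cV cx; rewrite /star_coord; case: xgetP => [r _|]; last by rewrite eqxx.
move=> [c' [i [c'V c'x -> ->]]]; rewrite normr_eq0 subr_eq0 => xVi.
have [f [f' [ff ff' dd]]] := glue cV c'V.
have fV : cube_face f' (co c' V) by apply/ff'.
have fx : cube_face f' (co c' x) by apply/ff'.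
have cw : in_cube c (nb c' V i).
  apply/ff'; first exact: nb_in.
  rewrite co_nb //; apply: face_flip => // [|b fi]; first exact: cornerV.
  case: fV => _ /(_ _ _ fi) Vi; case: fx => _ /(_ _ _ fi) xi.
  by rewrite Vi xi eqxx in xVi.
have c'w := nb_in i c'V.
have [|||j wj] := @corner_adjacent _ _ (co c V) (co c (nb c' V i)).
- exact: cornerV.
- apply: corner_indep c'w cw _; rewrite co_nb //; exact/corner_flip/cornerV.
- rewrite (dist_indep cV c'V cw c'w) co_nb // euclidean_sq (bigD1 i) //= big1 ?addr0.
    rewrite flipE eqxx; case: (cornerV c'V i) => ->;
      by rewrite ?subr0 ?sub0r ?subrr ?subr0 ?sqrrN expr1n.
  by move=> k /negPf ki; rewrite flipE ki subrr expr0n.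
by exists j; rewrite /nb -wj coE.
Qed.

Lemma star_coord_ge0 x w : 0 <= t x w.
Proof.
rewrite /star_coord; case: xgetP => [r _|] //.
by move=> [c [i [_ _ _ ->]]]; exact: normr_ge0.
Qed.

Lemma star_coord_le1 x w : t x w <= 1.
Proof.
rewrite /star_coord; case: xgetP => [r _|]; last by rewrite ler01.
move=> [c [i [cV cx _ ->]]]; rewrite ler_norml.
by have := co_unit cV i; have := co_unit cx i; lra.
Qed.

Lemma star_coord_sq c x y i : in_cube c V -> in_cube c x -> in_cube c y ->
  (t x (nb c V i) - t y (nb c V i)) ^+ 2 = (co c x 0 i - co c y 0 i) ^+ 2.
Proof.
move=> cV cx cy; rewrite !star_coordE //.
have /andP[x0 x1] := co_unit cx i; have /andP[y0 y1] := co_unit cy i.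
case: (cornerV cV i) => ->; first by rewrite !subr0 !ger0_norm.
rewrite !ler0_norm ?subr_le0 //; ring.
Qed.

Lemma star_coord_l2 c x y : in_cube c V -> in_cube c x -> in_cube c y ->
  l2_le (t x) (t y) (dist c x y).
Proof.
move=> cV cx cy F uF; rewrite euclidean_sq.
under [X in _ <= X]eq_bigr do rewrite -(star_coord_sq _ cV cx cy).
rewrite -(big_map (nb c V) xpredT (fun w => (t x w - t y w) ^+ 2)).
apply: sum_sub_le => // w; rewrite ?sqr_ge0 // sqrf_eq0 subr_eq0 => xy.
have [i ->] : exists i, w = nb c V i.
  have [x0|] := eqVneq (t x w) 0; last exact: star_coord_nb.
  by apply: (star_coord_nb cV cy); rewrite -x0 eq_sym.
by rewrite map_f // mem_index_enum.
Qed.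

Lemma dist_le_l2 c x y e : 0 <= e -> in_cube c V -> in_cube c x -> in_cube c y ->
  l2_le (t x) (t y) e -> dist c x y <= e.
Proof.
move=> e0 cV cx cy xy.
rewrite -(ler_pXn2r (ltn0Sn 1)) ?nnegrE ?euclidean_ge0 // euclidean_sq.
under eq_bigr do rewrite -(star_coord_sq _ cV cx cy).
rewrite -(big_map (nb c V) xpredT (fun w => (t x w - t y w) ^+ 2)); apply: xy.
by rewrite map_inj_uniq ?index_enum_uniq //; exact: nb_inj.
Qed.

Lemma star_coord_cell c f x w : cell (existT _ c f : cell_index C) V ->
  cell (existT _ c f : cell_index C) x -> t x w != 0 ->
  cell (existT _ c f : cell_index C) w.
Proof.
move=> /cubical_cellE[cV fV] /cubical_cellE[cx fx] xw.
have [i wi] := star_coord_nb cV cx xw; rewrite {}wi star_coordE // in xw *.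
apply/cubical_cellE; split; first exact: nb_in.
rewrite co_nb //; apply: face_flip => // [|b fi]; first exact: cornerV.
case: fV => _ /(_ _ _ fi) Vi; case: fx => _ /(_ _ _ fi) xi.
by rewrite Vi xi subrr normr0 eqxx in xw.
Qed.

(** Inside the star of V, a cell containing V is determined by the neighbours of V
    that it contains: if a face condition fails at y, the coordinate of y in this
    direction is non-zero and the corresponding neighbour violates the condition. *)
Lemma cell_star_coord c f y : cell (existT _ c f : cell_index C) V -> star V y ->
  (forall w, t y w != 0 -> cell (existT _ c f : cell_index C) w) ->
  cell (existT _ c f : cell_index C) y.
Proof.
move=> /cubical_cellE[cV fV] [c' c'V c'y] Hy.
have cy : in_cube c y.
  have [g [g' [gg gg' _]]] := glue cV c'V.
  apply/gg' => //; split=> [|j b gj]; first exact: co_unit.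
  have Vj : co c' V 0 j = b%:R by have [_] : cube_face g' (co c' V) by [apply/gg']; apply.
  have [->//|yVj] := eqVneq (co c' y 0 j) (co c' V 0 j).
  have /Hy/cubical_cellE[cw _] : t y (nb c' V j) != 0.
    by rewrite star_coordE // normr_eq0 subr_eq0.
  have [_ /(_ _ _ gj)] : cube_face g' (co c' (nb c' V j)) by apply/gg' => //; exact: nb_in.
  rewrite co_nb // flipE eqxx -Vj; case: (cornerV c'V j) => ->; lra.
apply/cubical_cellE; split=> //; split=> [|j b fj]; first exact: co_unit.
have Vj : co c V 0 j = b%:R by case: fV => _; exact.
have [->//|yVj] := eqVneq (co c y 0 j) (co c V 0 j).
have /Hy/cubical_cellE[_ [_ /(_ _ _ fj)]] : t y (nb c V j) != 0.
  by rewrite star_coordE // normr_eq0 subr_eq0.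
rewrite co_nb // flipE eqxx -Vj; case: (cornerV cV j) => ->; lra.
Qed.

(** A common face that contains y but not V is fixed, in some direction, at the
    value opposite to that of V; there y has coordinate 1. *)
Lemma star_exit c' y : star V y -> in_cube c' y -> (forall w, t y w < 1) ->
  in_cube c' V.
Proof.
move=> [c cV cy] c'y ty; have [f [f' [ff _ _]]] := glue cy c'y.
have [_ fy] : cube_face f (co c y) by apply/ff.
apply/ff => //; split=> [|j b fj]; first exact: co_unit.
have := ty (nb c V j); rewrite star_coordE // (fy _ _ fj).
case: (cornerV cV j) => ->; case: b {fj} => //=.
  by rewrite subr0 normr1 ltxx.
by rewrite sub0r normrN normr1 ltxx.
Qed.

Lemma star_chart : chart 1 (star V) t.
Proof.
move=> [c f] x y /cubical_cellE[cx _] /cubical_cellE[cy _] sx tx.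
have cV := star_exit sx cx tx.
by split; [exists c|exact: star_coord_l2].
Qed.

Lemma star_point c (g : X -> R) : in_cube c V -> (forall w, 0 <= g w <= 1) ->
  (forall w, g w != 0 -> exists i, w = nb c V i) ->
  exists2 q, in_cube c q & t q = g.
Proof.
move=> cV g01 gnb.
pose u : 'rV[R]_(cube_dim c) :=
  \row_i (co c V 0 i + (1 - 2 * co c V 0 i) * g (nb c V i)).
have uE i : u 0 i = co c V 0 i + (1 - 2 * co c V 0 i) * g (nb c V i) by rewrite mxE.
have qu : unit_cube u.
  move=> i; rewrite uE; have := g01 (nb c V i).
  by case: (cornerV cV i) => ->; lra.
have cq := in_cube_map qu; exists (cmap c u) => //; apply/funext => w.
have gE i : t (cmap c u) (nb c V i) = g (nb c V i).
  rewrite star_coordE // coK // uE [X in `|X|]addrAC subrr add0r normrM.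
  have /andP[g0 _] := g01 (nb c V i); rewrite (ger0_norm g0).
  case: (cornerV cV i) => ->; first by rewrite mulr0 subr0 normr1 mul1r.
  by rewrite mulr1 (_ : 1 - 2 = -1) ?normrN1 ?mul1r //; ring.
have [w0|] := eqVneq (t (cmap c u) w) 0; last first.
  by move=> /(star_coord_nb cV cq)[i ->].
rewrite w0; apply/esym/eqP; apply: contra_eqT w0 => gw.
by have [i wi] := gnb w gw; rewrite wi gE -wi.
Qed.

Lemma star_coord_finite x : star V x -> finite_set [set w | t x w != 0].
Proof.
move=> [c cV cx].
apply: (@sub_finite_set _ _ (range (nb c V))) => [w /= /(star_coord_nb cV cx)[i ->]|].
  by exists i.
exact/finite_image/finite_finset.
Qed.

Lemma star_coord_neighbor c i w : in_cube c V ->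
  t (nb c V i) w = (w == nb c V i)%:R.
Proof.
move=> cV; have cw := nb_in i cV.
have E j : t (nb c V i) (nb c V j) = (j == i)%:R.
  rewrite star_coordE // co_nb // flipE; case: eqP => _; last by rewrite subrr normr0.
  by case: (cornerV cV j) => ->; rewrite ?subrr ?subr0 ?sub0r ?normrN normr1.
have [->|wi] := eqVneq w (nb c V i); first by rewrite E eqxx.
have [//|] := eqVneq (t (nb c V i) w) 0.
move=> /(star_coord_nb cV cw)[j wj]; move: wi.
by rewrite wj E (inj_eq (nb_inj cV)) => /negPf ->.
Qed.

Lemma cubical_dist_ge0 : cell_dist_ge0 C.
Proof. by move=> i x y _ _; exact: euclidean_ge0. Qed.

Definition full_cell c : cell_index C := existT _ c (fun=> None).

Lemma full_cellE c x : cell (full_cell c) x <-> in_cube c x.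
Proof.
split=> [/cubical_cellE[]|cx] //; apply/cubical_cellE; split=> //; split=> //.
exact: co_unit.
Qed.

(** The limit vector is a point q of one cube through V.  Late terms lie in cubes
    through V with all directions in which q is non-zero, hence containing q. *)
Lemma star_limit (u : nat -> X) (x : X -> R) : (forall n, star V (u n)) ->
  l2_cvg (fun n => t (u n)) x -> finite_set [set w | x w != 0] ->
  exists q, converges_to u q.
Proof.
move=> su ux fx.
have x0 := l2_cvg_ge0 ux (fun n => star_coord_ge0 (u n)).
have x1 := l2_cvg_le ux (fun n => star_coord_le1 (u n)).
have [|N HN] := l2_cvg_neq0 ux (F := fset_set [set w | x w != 0]).
  by move=> w; rewrite in_fset_set // inE.
have supp n w : (N <= n)%N -> x w != 0 -> t (u n) w != 0.
  by move=> Nn xw; apply: HN => //; rewrite in_fset_set // inE.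
have [c cV cu] := su N.
have [w|w xw|q cq qx] := @star_point c x cV; first by rewrite x0 x1.
  exact: (star_coord_nb cV cu (supp N w (leqnn N) xw)).
have sq : star V q by exists c.
exists q => e e0; have e20 : 0 < e / 2 by lra.
have [N' HN'] := ux _ e20; exists (maxn N N') => n; rewrite geq_max => /andP[Nn N'n].
have [d dV du] := su n.
have dq : in_cube d q.
  apply/full_cellE; apply: cell_star_coord => // [|w]; first exact/full_cellE.
  rewrite qx => /(supp n w Nn)/(star_coord_nb dV du)[i ->].
  exact/full_cellE/nb_in.
apply: (@le_lt_trans _ _ (e / 2)); last by lra.
apply: le_trans (path_dist_le_cell cubical_dist_ge0 (i := full_cell d) _ _) _.
- exact/full_cellE.
- exact/full_cellE.
by apply: (dist_le_l2 (ltW e20) dV du dq); rewrite qx; exact: HN'.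
Qed.

(** Neighbours of V along which one point of the star has non-zero coordinates all
    lie in a common cube, so they span a cell with V; the description of this cell
    by coordinates shows that the choice of the cube is immaterial. *)
Lemma star_span (S : set X) p : star V p -> (forall w, S w -> t p w != 0) ->
  exists s : cell_index C, forall y,
    cell s y <-> star V y /\ forall w, t y w != 0 -> S w.
Proof.
move=> [c cV cp] Sp.
pose f i : option bool :=
  if `[< S (nb c V i) >] then None else Some (co c V 0 i == 1).
have cellV : cell (existT _ c f : cell_index C) V.
  apply/cubical_cellE; split=> //; split=> [|i b]; first exact: co_unit.
  rewrite /f; case: ifP => // _ [<-].
  by case: (cornerV cV i) => ->; rewrite ?eqxx // eq_sym oner_eq0.
exists (existT _ c f) => y; split=> [ys|[sy Sy]].
  have /cubical_cellE[cy [_ fy]] := ys.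
  split=> [|w yw]; first by exists c.
  have [i wi] := star_coord_nb cV cy yw; rewrite wi; apply: contrapT => nS.
  have fi : f i = Some (co c V 0 i == 1) by rewrite /f asboolF.
  move: yw; rewrite wi star_coordE // (fy _ _ fi).
  by case: (cornerV cV i) => ->; rewrite ?eqxx ?(eq_sym 0) ?oner_eq0 subrr normr0 eqxx.
apply: cell_star_coord => // w /Sy Sw.
have [i wi] := star_coord_nb cV cp (Sp _ Sw).
apply/cubical_cellE; rewrite wi; split; first exact: nb_in.
rewrite co_nb //; apply: face_flip; first exact: cornerV.
  by have /cubical_cellE[] := cellV.
by move=> b; rewrite /f -wi asboolT.
Qed.

Lemma star_ascending (e : nat -> X) : injective e ->
  (forall n, exists2 p, star V p & forall i, (i < n)%N -> t p (e i) != 0) ->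
  exists s : nat -> cell_index C, infinite_ascending s.
Proof.
move=> einj He.
have /choice[s sE] n : exists s : cell_index C, forall y, cell s y <->
    star V y /\ forall w, t y w != 0 -> exists2 i, (i < n)%N & w = e i.
  have [p sp pe] := He n.
  apply: (@star_span [set w | exists2 i, (i < n)%N & w = e i] p) => //.
  by move=> w [i lin ->]; exact: pe.
exists s => n; split=> [y /sE[sy Sy]|/(_ (e n)) H].
  by apply/sE; split=> // w /Sy[i lin wi]; exists i => //; exact: ltnW.
have [p [c cV cp] /(_ n (ltnSn n)) /(star_coord_nb cV cp)[j ej]] := He n.+1.
have tn w : t (e n) w = (w == e n)%:R by rewrite ej; exact: star_coord_neighbor.
have /H/sE[_ /(_ (e n))] : cell (s n.+1) (e n).
  apply/sE; split=> [|w]; first by exists c => //; rewrite ej; exact: nb_in.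
  by rewrite tn; have [-> _|_] := eqVneq w; [exists n|rewrite eqxx].
by rewrite tn eqxx oner_eq0 => -[//|i lin /einj ni]; rewrite ni ltnn in lin.
Qed.

End Star.

Lemma cubical_covered x : exists s : cell_index C, cell s x.
Proof.
have [c [u [qu ux]]] := cube_map_cover x.
by exists (full_cell c); apply/full_cellE; exists u.
Qed.

(** V is obtained by rounding the coordinates of p in a cube to 0 or 1. *)
Lemma star_cover p :
  exists2 V, is_corner V & star V p /\ forall w, star_coord V p w <= 1 / 2.
Proof.
have [c [u [qu ux]]] := cube_map_cover p.
have cp : in_cube c p by exists u.
pose v : 'rV[R]_(cube_dim c) := \row_i (1 / 2 < co c p 0 i)%R%:R.
have kv : corner v by move=> i; rewrite mxE; case: (_ < _); [right|left].
have qv := corner_unit_cube kv.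
have cV := in_cube_map qv.
have HV : is_corner (cmap c v) by exists c => //; rewrite coK.
exists (cmap c v) => //; split=> [|w]; first by exists c.
have [->|] := eqVneq (star_coord (cmap c v) p w) 0; first by lra.
move=> /(star_coord_nb HV cV cp)[i ->]; rewrite star_coordE // coK // mxE ler_norml.
have /andP[p0 p1] := co_unit cp i.
by case: ltP => /=; lra.
Qed.

Lemma cubical_complete : connected [set: X] ->
  ~ (exists s : nat -> cell_index C, infinite_ascending s) -> path_metric_complete C.
Proof.
move=> conn nasc; have jo := joined_connected cubical_covered conn.
have r0 : 0 < 1 / 2 :> R by lra.
refine (@complete_of_charts _ C X {V : X | is_corner V} 1 (1 / 2)
  (fun j => star (sval j)) (fun j => star_coord (sval j))
  cubical_dist_ge0 jo r0 _ _ _ _ nasc).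
- by move=> [V HV]; exact: star_chart.
- move=> p; have [V HV [Vp tp]] := star_cover p.
  by exists (exist _ V HV) => //= w; have := tp w; lra.
- by move=> [V HV]; exact: star_limit.
- by move=> [V HV]; exact: star_ascending.
Qed.

(** V is a corner of the first cell.  The cell s n.+1 contains a neighbour e n of V which
    is not in s n, by [cell_star_coord]; the point u n has coordinate
    2^-(i+1) at e i for i < n. *)
Lemma cubical_incomplete (s : nat -> cell_index C) :
  connected [set: X] -> infinite_ascending s -> ~ path_metric_complete C.
Proof.
move=> conn asc; have jo := joined_connected cubical_covered conn.
have smono m n : (m <= n)%N -> cell (s m) `<=` cell (s n).
  move=> /subnKC <-; elim: (n - m)%N => [|k IH] x; first by rewrite addn0.
  by rewrite addnS => /IH; case: (asc (m + k)%N) => + _; exact.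
have [V HV V0] : exists2 V, is_corner V & cell (s 0%N) V.
  case: (s 0%N) => c f.
  pose v : 'rV[R]_(cube_dim c) := \row_i (if f i is Some b then b else false)%:R.
  have kv : corner v by move=> i; rewrite mxE; case: (f i) => [[]|]; [right|left|left].
  have qv := corner_unit_cube kv; have cv := in_cube_map qv.
  exists (cmap c v); first by exists c => //; rewrite coK.
  apply/cubical_cellE; split=> //; rewrite coK //; split=> // i b fi.
  by rewrite mxE fi.
pose c n := projT1 (s n); pose t := star_coord V.
have sV n : cell (s n) V by exact: smono V0.
have sc n x : cell (s n) x -> in_cube (c n) x.
  by rewrite /c; case: (s n) => d f /cubical_cellE[].
have cV n : in_cube (c n) V by exact: sc.
have /choice[e eP] n : exists w, [/\ cell (s n.+1) w, ~ cell (s n) w & t w w != 0].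
  have [_ nsub] := asc n; apply: contrapT => H; apply: nsub => y yn.
  have sy : star V y by exists (c n.+1) => //; exact: sc.
  move: (sV n) (sV n.+1) yn H; case En: (s n) => [d f]; case En1: (s n.+1) => [d' f'].
  move=> dV d'V d'y H; apply: (cell_star_coord HV dV sy) => w yw.
  apply: contrapT => nw; apply: H; exists w; split=> //.
    exact: star_coord_cell d'V d'y yw.
  have [d'V' _] := (cubical_cellE _ _).1 d'V.
  have [d'y' _] := (cubical_cellE _ _).1 d'y.
  have [i ->] := star_coord_nb HV d'V' d'y' yw.
  by rewrite /t star_coord_neighbor // eqxx oner_eq0.
have es i n : (i < n)%N -> cell (s n) (e i).
  by move=> lin; apply: (smono _ _ lin); case: (eP i).
have einj : injective e.
  have lt_neq i j : (i < j)%N -> e i <> e j.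
    by move=> ij eij; have [_ + _] := eP j; apply; rewrite -eij; exact: es.
  by move=> i j eij; case: (ltngtP i j) => // /lt_neq; rewrite eij.
have enb i n : (i < n)%N -> exists j, e i = nb (c n) V j.
  move=> lin; have [_ _ tee] := eP i.
  by apply: (star_coord_nb HV (cV n) _ tee); exact/sc/es.
pose a i : R := 2%:R ^- i.+1.
have a0 i : 0 < a i by rewrite invr_gt0 exprn_gt0.
have a2 i : a i <= 1 / 2.
  rewrite mul1r lef_pV2 ?posrE ?exprn_gt0 // exprS ler_peMr ?ler0n //.
  by rewrite exprn_ege1 // ler1n.
have ga n i : 0 <= spread e a n (e i) <= a i.
  have [lin|nli] := ltnP i n; first by rewrite spreadE // lexx ltW.
  by rewrite spreadE0 // lexx ltW.
have g2 n w : 0 <= spread e a n w <= 1 / 2.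
  have [->|/spread_neq0[i _ ->]] := eqVneq (spread e a n w) 0; first by lra.
  by have := ga n i; have := a2 i; lra.
have /choice[u uP] n : exists q, in_cube (c n) q /\ t q = spread e a n.
  have [|w /spread_neq0[i lin ->]|q cq qg] := @star_point V HV (c n) (spread e a n) (cV n).
  - by move=> w; have := g2 n w; lra.
  - exact: enb.
  - by exists q.
have cu m n : (m <= n)%N -> in_cube (c n) (u m).
  move=> mn; apply/full_cellE; apply: (cell_star_coord HV).
  - exact/full_cellE.
  - by exists (c m) => //; case: (uP m).
  - move=> w; have [_ +] := uP m; rewrite /t => -> /spread_neq0[i lim ->].
    exact/full_cellE/sc/es/(leq_trans lim).
have ua i n : (i < n)%N -> t (u n) (e i) = a i.
  by move=> lin; have [_ ->] := uP n; exact: spreadE.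
have r0 : 0 < 1 / 2 :> R by lra.
have a_neq0 i : a i != 0 by rewrite gt_eqF.
apply: (incomplete_of_chart cubical_dist_ge0 jo r0 (star_chart HV) _ _ _ einj a_neq0 ua).
- by move=> x; exact: star_coord_finite.
- by move=> n; exists (c n) => //; case: (uP n).
- by move=> n w; have [_ tu] := uP n; rewrite -/t tu; have := g2 n w; lra.
move=> eta eta0; have e20 : 0 < eta / 2 by lra.
have [N HN] := small_half (exprn_gt0 2 e20); exists N => m n Nm Nn.
pose k := maxn m n.
have um : in_cube (c k) (u m) by apply: cu; exact: leq_maxl.
have un : in_cube (c k) (u n) by apply: cu; exact: leq_maxr.
apply: (@le_lt_trans _ _ (eta / 2)); last by lra.
apply: le_trans (path_dist_le_cell cubical_dist_ge0 (i := full_cell (c k)) _ _) _.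
- exact/full_cellE.
- exact/full_cellE.
apply: (dist_le_l2 HV (ltW e20) (cV k) um un); have [_ +] := uP m; have [_ +] := uP n.
rewrite /t => -> -> F uF; apply: le_trans (ltW HN).
(* u m and u n differ only in directions e i with N <= i < k. *)
apply: (@le_trans _ _ (\sum_(w <- [seq e i | i <- index_iota N k])
    (spread e a m w - spread e a n w) ^+ 2)).
  apply: sum_sub_le => // w; rewrite ?sqr_ge0 // sqrf_eq0 subr_eq0 => gmn.
  have [i lik wi] : exists2 i, (i < k)%N & w = e i.
    have [gm0|/spread_neq0[i lim ->]] := eqVneq (spread e a m w) 0; last first.
      by exists i => //; apply: leq_trans lim _; exact: leq_maxl.
    have /spread_neq0[i lin ->] : spread e a n w != 0 by rewrite -gm0 eq_sym.
    by exists i => //; apply: leq_trans lin _; exact: leq_maxr.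
  rewrite wi map_f // mem_index_iota lik andbT leqNgt; apply/negP => liN.
  by move: gmn; rewrite wi !spreadE ?eqxx // (leq_trans liN).
have Nk : (N <= k)%N by apply: leq_trans Nm _; exact: leq_maxl.
rewrite big_map; apply: (@le_trans _ _ (\sum_(N <= i < k) a i)).
  apply: ler_sum => i _; have := ga m i; have := ga n i; have := a2 i; have := a0 i.
  move: (spread e a m (e i)) (spread e a n (e i)) (a i) => x y z; nra.
by rewrite sum_half_tail // gerBl ltW // invr_gt0 exprn_gt0.
Qed.

End CubeCoord.

Theorem theoremA6 (R : realType) :
  (forall K : simplicial_complex,
     connected [set: carrier (all_right R K)] ->
     (path_metric_complete (all_right R K) <->
      ~ exists s : nat -> cell_index (all_right R K), infinite_ascending s))
  /\
  (forall K : cubical_complex R,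
     connected [set: carrier (cubical_cells K)] ->
     (path_metric_complete (cubical_cells K) <->
      ~ exists s : nat -> cell_index (cubical_cells K), infinite_ascending s)).
Proof.
split=> K conn; split.
- by move=> compl [s asc]; exact: simplicial_incomplete conn asc compl.
- exact: simplicial_complete.
- by move=> compl [s asc]; exact: cubical_incomplete conn asc compl.
- exact: cubical_complete.
Qed.
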